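(* Let $\mu$ be a probability measure on $\mathbb{R}$. Assume that $\sup_{x\in\mathbb{R}}[U_\mu(x+1)-U_\mu(x)]\le h$ for some $h>0$. Set $K:=2740$ and $c:=1/(10\sqrt2)$. Then, for all convex or concave and $l$-Lipschitz functions $g:\mathbb{R}\to\mathbb{R}$ with $l\le c/h$, it holds $$\mathrm{Ent}_\mu(e^g)\le Kh^2\int_{\mathbb{R}}|\nabla g(x)|^2e^{g(x)}\,\mu(dx).$$
   Context: The map $U_\mu$: let $F_\mu(x)=\mu((-\infty,x])$ and $F_\mu^{-1}(u)=\inf\{x\in\mathbb{R}:F_\mu(x)\ge u\}$ for $u\in[0,1]$; let $\tau(dx)=\frac12e^{-|x|}dx$ be the symmetric exponential distribution. Then $U_\mu:=F_\mu^{-1}\circ F_\tau:\mathbb{R}\to\mathbb{R}$. Entropy: $\mathrm{Ent}_\mu(e^g)=\int g e^g\,d\mu-\left(\int e^g\,d\mu\right)\log\left(\int e^g\,d\mu\right)$. For a convex or concave function $g:\mathbb{R}\to\mathbb{R}$ with left and right derivatives $g'_-$, $g'_+$, $$|\nabla g(x)|=|\nabla g|(x):=\min\{|s g'_-(x)+(1-s)g'_+(x)|: s\in[0,1]\}.$$ *)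

(* Defs.v *)
From HB Require Import structures.
From mathcomp Require Import all_boot all_order all_algebra.
From mathcomp Require Import all_classical all_reals all_analysis.
From mathcomp Require Import measurable_realfun.

Set Implicit Arguments.
Unset Strict Implicit.
Unset Printing Implicit Defensive.

Import Order.TTheory GRing.Theory Num.Theory.
Import numFieldNormedType.Exports.

Local Open Scope classical_set_scope.
Local Open Scope ring_scope.

Definition symexp_pdf {R : realType} (x : R) : R := expR (- `|x|) / 2.

Definition symexp_prob (R : realType) (A : set (measurableTypeR R)) : \bar R :=
  (\int[lebesgue_measure]_(x in A) (symexp_pdf x)%:E)%E.

Section symexp_prob.
Context {R : realType}.
Local Notation leb := (@lebesgue_measure R).

Lemma symexp_pdf_ge0 (x : R) : 0 <= symexp_pdf x.
Proof. by rewrite /symexp_pdf divr_ge0 ?expR_ge0. Qed.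

Lemma continuous_symexp_pdf : continuous (@symexp_pdf R).
Proof.
move=> x; rewrite /symexp_pdf; apply: cvgM; last exact: cvg_cst.
apply: (@continuous_comp _ _ _ (fun y : R => - `|y|) (@expR R)).
  by apply: cvgN; exact: norm_continuous.
exact: continuous_expR.
Qed.

Lemma measurable_symexp_pdf : measurable_fun [set: R] (@symexp_pdf R).
Proof. exact: (continuous_measurable_fun continuous_symexp_pdf). Qed.

Lemma integral_symexp_pdf : (\int[leb]_x (symexp_pdf x)%:E = 1)%E.
Proof.
rewrite ge0_symfun_integralT; first last.
- by move=> x /=; rewrite /symexp_pdf normrN.
- exact: continuous_symexp_pdf.
- exact: symexp_pdf_ge0.
have -> : [set x : R | (0 <= x)%R] = `[0%R, +oo[%classic.
  by apply/seteqP; split => x /=; rewrite in_itv /= andbT.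
rewrite -ge0_integralZl//; first last.
- by move=> x _; rewrite lee_fin symexp_pdf_ge0.
- by apply/measurable_EFinP/measurable_funTS; exact: measurable_symexp_pdf.
rewrite -(@integral_exponential_pdf R 1)// [RHS](_ : _ =
    \int[leb]_(x in `[0%R, +oo[) (exponential_pdf 1 x)%:E)%E; last first.
  rewrite [RHS]integral_mkcond; apply: eq_integral => x _.
  rewrite patchE; case: ifPn => // /negP x0.
  rewrite lt0_exponential_pdf// ltNge; apply/negP => x1; apply: x0.
  by rewrite inE /= in_itv /= x1.
apply: eq_integral => x; rewrite inE /= in_itv /= andbT => x0.
rewrite exponential_pdfE// /symexp_pdf ger0_norm// mulN1r mul1r -EFinM.
by rewrite mulrCA divff ?mulr1.
Qed.

Local Notation tau := (@symexp_prob R).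

Let tau0 : tau set0 = 0%E.
Proof. by rewrite /symexp_prob integral_set0. Qed.

Let tau_ge0 A : (0 <= tau A)%E.
Proof. by apply: integral_ge0 => x _; rewrite lee_fin symexp_pdf_ge0. Qed.

Let tau_sigma_additive : semi_sigma_additive tau.
Proof.
move=> /= F mF tF mUF; rewrite /symexp_prob; apply: cvg_toP.
  apply: ereal_nondecreasing_is_cvgn => m n mn.
  apply: lee_sum_nneg_natr => // k _ _; apply: integral_ge0 => /= x Fkx.
  by rewrite lee_fin symexp_pdf_ge0.
rewrite ge0_integral_bigcup//=.
- by apply/measurable_EFinP/measurable_funTS; exact: measurable_symexp_pdf.
- by move=> x _; rewrite lee_fin symexp_pdf_ge0.
Qed.

HB.instance Definition _ := isMeasure.Build _ _ _ tau
  tau0 tau_ge0 tau_sigma_additive.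

Let tau_setT : tau [set: R] = 1%E.
Proof. by rewrite /symexp_prob integral_symexp_pdf. Qed.

HB.instance Definition _ := @Measure_isProbability.Build _ _ R tau tau_setT.

End symexp_prob.
Arguments symexp_prob R A : clear implicits.

Section transport_map.
Context {R : realType}.
Implicit Type mu : probability (measurableTypeR R) R.

Definition distr_fun mu (x : R) : \bar R := mu `]-oo, x]%classic.

Definition quantile mu (u : \bar R) : \bar R :=
  ereal_inf [set x%:E | x in [set x : R | (u <= distr_fun mu x)%E]].

(* The quantile function is infinite at u = 0 (and possibly at u = 1), but *)
(* distr_fun (symexp_prob R) takes its values in ]0, 1[, where the         *)
(* quantile function is finite, so that fine loses nothing here.           *)
Definition transport_map mu (x : R) : R :=
  fine (quantile mu (distr_fun (symexp_prob R) x)).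

End transport_map.

(* Entropy of e^g, as a function of g *)
Definition entropy_exp {R : realType}
    (mu : probability (measurableTypeR R) R) (g : R -> R) : \bar R :=
  (\int[mu]_x (g x * expR (g x))%:E -
   (\int[mu]_x (expR (g x))%:E) * lne (\int[mu]_x (expR (g x))%:E))%E.

Section one_sided_gradient.
Context {R : realType}.
Implicit Type g : R -> R.

Definition left_derivative g (x : R) : R :=
  lim ((g y - g x) / (y - x) @[y --> x^'-]).

Definition right_derivative g (x : R) : R :=
  lim ((g y - g x) / (y - x) @[y --> x^'+]).

(* The infimum is a minimum, by compactness of `[0, 1]. *)
Definition abs_grad g (x : R) : R :=
  inf [set `|s * left_derivative g x + (1 - s) * right_derivative g x|
      | s in `[0, 1]].

End one_sided_gradient.

Definition convex_on_line {R : realType} (g : R -> R) : Prop :=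
  @convex_function R R^o [set: R^o] g.

Definition concave_on_line {R : realType} (g : R -> R) : Prop :=
  convex_on_line (fun x => - g x).

(* Main.v *)
Require Import Defs.
From HB Require Import structures.
From mathcomp Require Import all_boot all_order all_algebra.
From mathcomp Require Import all_classical all_reals all_analysis.
From mathcomp Require Import measurable_realfun.
From mathcomp Require Import ring lra.

(** Write [U] for the transport map, so that [mu] is the image of the symmetric
    exponential law [tau] by [U], and put [F x = g (U x) - g (U 0)] and
    [D x = abs_grad g (U x)].  With [phi u = 1 + (u - 1) e^u], the variational
    formula for the entropy gives
      [Ent_mu (e^g) <= e^(g (U 0)) * E_tau [phi (F)]],
    so it is enough to bound [E_tau [phi (F)]] by a multiple of
    [h^2 * E_tau [D^2 e^F]].

    The key property of [tau] is its memorylessness.  Let [T] move every point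
    one unit towards [0] and send the points of modulus at most [1] to [0].  Then
    [E_tau [J (T X)] = e^-1 E_tau [J (X)]] as soon as [J 0 = 0]
    ([integral_soft_threshold]).  Hence a pointwise one-step inequality
    [J x <= A * J (T x) + E x] with [A < e] integrates to
    [E_tau [J] <= C * E_tau [E]] ([exponential_hardy]): this is a Hardy
    inequality that uses increments of [U] over unit steps only, and these
    are bounded by [h] although [U] itself may jump.

    For convex [g] the gradient at [x] bounds how far [g x] lies above the other
    values of [g]: [g x - g y <= abs_grad g x * |x - y|].  So the positive part
    [P] of [F] satisfies [P x <= P (T x) + h * D x], and [J = P^2 e^P] satisfies
    a one-step inequality, because [P] moves by at most [l * h <= 1 / 10] per
    step ([sqr_expR_step]).  The same inequality read at the base point bounds
    the negative part of [F] by [D 0 * h * (|x| + 1)], whose square is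
    [tau]-integrable, and [(D 0)^2] is at most a multiple of [E_tau [D^2 e^F]],
    because on at least one side of [U 0] the gradient of a convex function is
    not smaller than at [U 0].  For concave [g] the two parts of [F] exchange their roles;
    the one-step inequality is then applied to [phi] of the negative part
    ([entropy_gap_step]), which, unlike the square, keeps the weight [e^F]. *)

Set Implicit Arguments.
Unset Strict Implicit.
Unset Printing Implicit Defensive.

Import Order.TTheory GRing.Theory Num.Theory.
Import numFieldNormedType.Exports.

Local Open Scope classical_set_scope.
Local Open Scope ring_scope.

(** * The entropy integrand and its one-step inequalities *)

(** [expR c * entropy_gap (t - c)] is the Bregman divergence of [x * ln x] from
    [expR c] to [expR t]: the gap at [expR t] between this function and its
    tangent at [expR c]. *)
Definition entropy_gap {R : realType} (u : R) : R := 1 + (u - 1) * expR u.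

Section elementary.
Context {R : realType}.
Implicit Types u v s t : R.
Local Notation phi := (@entropy_gap R).

Lemma expR_mul1B_le1 u : expR u * (1 - u) <= 1.
Proof.
rewrite -[leRHS](expRxMexpNx_1 u); apply: ler_wpM2l; first exact: expR_ge0.
by have := expR_ge1Dx (- u).
Qed.

Lemma expR_onethird_le : expR (1 / 3) <= 3 / 2 :> R.
Proof. by have := expR_mul1B_le1 (1 / 3); lra. Qed.

Lemma expR_onetenth_le : expR (1 / 10) <= 9 / 8 :> R.
Proof. by have := expR_mul1B_le1 (1 / 10); lra. Qed.

Lemma expRN1_le : expR (- 1) <= 1 / 2 :> R.
Proof.
have := @expR_ge1Dx R 1; rewrite expRN => h.
by rewrite div1r lef_pV2 ?posrE ?expR_gt0//; lra.
Qed.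

Lemma expRN1_ge : 1 / 4 <= expR (- 1) :> R.
Proof.
have h := @expR_ge1Dx R (- (1 / 2)).
have -> : -1 = - (1 / 2) + - (1 / 2) :> R by lra.
by rewrite expRD; nra.
Qed.

Lemma le_5expR t : t <= 5 * expR (t / 10).
Proof.
have h := @expR_ge1Dx R (t / 20).
have e : expR (t / 10) = expR (t / 20) * expR (t / 20) by rewrite -expRD; congr expR; lra.
have [t0|t0] := leP t 0; first by have := expR_ge0 (t / 10); lra.
have : (1 + t / 20) * (1 + t / 20) <= expR (t / 20) * expR (t / 20).
  by apply: ler_pM => //; lra.
have := sqr_ge0 (1 - t / 20); rewrite e expr2; lra.
Qed.

(** Polynomial growth costs a small exponential rate: it reduces every moment
    needed below to a single exponential moment of rate [1 / 3]. *)
Lemma sqr_expR_le t : 0 <= t -> t ^+ 2 * expR (t / 10) <= 25 * expR (t / 3).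
Proof.
move=> t0; have t2 : t ^+ 2 <= 25 * expR (t / 5).
  have -> : 25 * expR (t / 5) = (5 * expR (t / 10)) ^+ 2.
    have -> : t / 5 = t / 10 + t / 10 by lra.
    by rewrite expRD expr2; lra.
  by rewrite ler_sqr ?nnegrE ?mulr_ge0 ?expR_ge0 ?le_5expR.
apply: le_trans (ler_wpM2r (expR_ge0 _) t2) _.
by rewrite -mulrA -expRD ler_pM2l ?ler_expR//; lra.
Qed.

Lemma entropy_gap_ge0 u : 0 <= phi u.
Proof.
have := expR_ge1Dx (- u); rewrite expRN => h.
have e := expR_gt0 u.
rewrite /entropy_gap -[X in X + _](@mulVf _ (expR u)) ?gt_eqF// -mulrDl.
by apply: mulr_ge0; [lra|exact: ltW].
Qed.

Lemma entropy_gap0 : phi 0 = 0.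
Proof. by rewrite /entropy_gap expR0; lra. Qed.

Lemma entropy_gap_le_pos u : 0 <= u -> phi u <= u ^+ 2 * expR u.
Proof.
move=> u0; have h := expR_ge1Dx u.
have q0 : 0 <= 1 - u + u ^+ 2 by have := sqr_ge0 (1 - u / 2); rewrite !expr2; nra.
have := ler_wpM2r q0 h; have := exprn_ge0 3 u0; rewrite /entropy_gap !exprS expr0; lra.
Qed.

Lemma entropy_gap_le_neg u : u <= 0 -> phi u <= u ^+ 2.
Proof. by move=> u0; have h := expR_ge1Dx u; rewrite /entropy_gap expr2; nra. Qed.

(** The converse of [entropy_gap_le_neg] holds only with the weight [expR u],
    since [entropy_gap] is bounded on the negative half-line. *)
Lemma entropy_gap_ge_neg u : u <= 0 -> u ^+ 2 * expR u <= 4 * phi u.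
Proof.
move=> u0; have h := @expR_ge1Dx R (- u / 2).
have e : expR (- u) = expR (- u / 2) * expR (- u / 2) by rewrite -expRD; congr expR; lra.
have e1 : expR u * expR (- u) = 1 by rewrite expRxMexpNx_1.
have e0 := expR_gt0 u.
have : 1 - u + u ^+ 2 / 4 <= expR (- u) by rewrite e expr2; nra.
move=> /(ler_wpM2l (ltW e0)); rewrite e1 /entropy_gap; lra.
Qed.

Lemma entropy_gap_nonincr u v : u <= v -> v <= 0 -> phi v <= phi u.
Proof.
move=> uv v0; have h := expR_ge1Dx (u - v); have := expR_gt0 v.
have -> : phi u = 1 + (u - 1) * (expR v * expR (u - v)).
  by rewrite -expRD /entropy_gap; congr (_ + _ * expR _); lra.
rewrite /entropy_gap => e.
suff : (v - 1) <= (u - 1) * expR (u - v) by move=> /(ler_wpM2l (ltW e)); lra.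
(* e^{u-v} <= 1/(1+v-u) and (1-v)(1+v-u) >= 1-u *)
have : expR (u - v) * (1 + v - u) <= 1.
  have := expR_ge1Dx (v - u); have -> : v - u = - (u - v) by lra.
  have := expRxMexpNx_1 (u - v); have := expR_gt0 (u - v); nra.
have := expR_gt0 (u - v); nra.
Qed.

(** The derivative of [entropy_gap] is [u * expR u], so a descent by [d = u - v]
    adds about [d * |u| * expR u], which is split into a small multiple of
    [u ^+ 2 * expR u], absorbed by [entropy_gap_ge_neg], and a multiple of
    [d ^+ 2 * expR u]; a step of length [1 / 10] changes [expR] by a bounded
    factor.  What matters is that [3 / 2] is less than [expR 1]. *)
Lemma entropy_gap_step u v s : u <= 0 -> v <= 0 -> 0 <= s -> u - v <= s ->
  u - v <= 1 / 10 -> phi v <= 3 / 2 * phi u + 5 * s ^+ 2 * expR v.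
Proof.
move=> u0 v0 s0 uvs uv1.
have pu := entropy_gap_ge0 u; have ev := expR_gt0 v.
have [uv|vu] := leP u v.
  have := entropy_gap_nonincr uv v0.
  suff : 0 <= 5 * s ^+ 2 * expR v by lra.
  by rewrite expr2; nra.
set d := u - v; have d0 : 0 < d by rewrite /d; lra.
have hd := expR_ge1Dx (- d).
have eu := expR_gt0 u.
have evE : expR v = expR u * expR (- d) by rewrite -expRD /d; congr expR; lra.
have step : phi v <= phi u + d * (d - u) * expR u.
  rewrite /entropy_gap evE.
  suff : (v - 1) * expR (- d) <= u - 1 + d * (d - u).
    by move=> /(ler_wpM2l (ltW eu)); lra.
  rewrite /d in hd *; nra.
have low := entropy_gap_ge_neg u0.
have eV : expR u <= 9 / 8 * expR v.
  have -> : expR u = expR d * expR v by rewrite -expRD /d; congr expR; lra.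
  apply: ler_wpM2r; first exact: ltW.
  by apply: le_trans expR_onetenth_le; rewrite ler_expR.
have ds : d ^+ 2 <= s ^+ 2 by rewrite ler_sqr ?nnegrE// ltW.
have : d * (d - u) * expR u <= (3 * d ^+ 2 + u ^+ 2 / 8) * expR u.
  by apply: ler_wpM2r; [exact: ltW|have := sqr_ge0 (4 * d + u); rewrite !expr2; lra].
have : 3 * d ^+ 2 * expR u <= 3 * s ^+ 2 * (9 / 8 * expR v).
  by apply: ler_pM; rewrite ?mulr_ge0 ?sqr_ge0 ?(ltW eu)//; lra.
have : 0 <= s ^+ 2 * expR v by rewrite expr2; nra.
by lra.
Qed.

(** Splitting the square costs a factor [5 / 4] and the change of the weight a
    factor [9 / 8]; their product is below [3 / 2]. *)
Lemma sqr_expR_step u v s : 0 <= u -> 0 <= v -> 0 <= s -> v - u <= s ->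
  v - u <= 1 / 10 ->
  v ^+ 2 * expR v <= 3 / 2 * (u ^+ 2 * expR u) + 5 * s ^+ 2 * expR v.
Proof.
move=> u0 v0 s0 vus vu1; have ev := expR_gt0 v; have eu := expR_gt0 u.
have v2 : v ^+ 2 <= 5 / 4 * u ^+ 2 + 5 * s ^+ 2.
  have : v ^+ 2 <= (u + s) ^+ 2 by rewrite ler_sqr ?nnegrE; lra.
  have := sqr_ge0 (u / 2 - 2 * s); rewrite !expr2; nra.
have eV : expR v <= 9 / 8 * expR u.
  have -> : expR v = expR (v - u) * expR u by rewrite -expRD; congr expR; lra.
  apply: ler_wpM2r; first exact: ltW.
  by apply: le_trans expR_onetenth_le; rewrite ler_expR.
have h1 := ler_wpM2r (ltW ev) v2.
have h2 := ler_wpM2l (sqr_ge0 u) eV.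
have : 0 <= u ^+ 2 * expR u by rewrite mulr_ge0 ?sqr_ge0 ?ltW.
lra.
Qed.

End elementary.

(** * Memorylessness of the exponential law and a Hardy inequality *)

Section memoryless.
Context {R : realType}.
Local Notation leb := (@lebesgue_measure R).
Local Notation tau := (@symexp_prob R).
Local Notation MR := (measurableTypeR R).

Let translation (c : R) : MR -> MR := fun x => x - c.

Let measurable_translation c : measurable_fun [set: MR] (translation c).
Proof. by apply: measurable_funB => //; exact: measurable_cst. Qed.

Lemma lebesgue_measure_translation (c : R) (A : set MR) : measurable A ->
  pushforward leb (translation c) A = leb A.
Proof.
move=> mA; apply/esym/lebesgue_measure_unique => //= _ [[a b]] _ <-.
rewrite /pushforward.
have -> : translation c @^-1` `]a, b]%classic = `]a + c, b + c]%classic.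
  by apply/seteqP; split => x; rewrite /translation /= !in_itv/= ltrBrDr lerBlDr.
by rewrite !lebesgue_measure_itv/= !lte_fin ltrD2r -!EFinD opprD addrACA subrr addr0.
Qed.

(** By the translation invariance of the Lebesgue measure, a multiplicative
    relation between the density and its translate, as the exponential density
    has on each half-line, passes to the measure of sets. *)
Lemma symexp_prob_translation (c k : R) (A : set MR) : measurable A -> 0 <= k ->
  (forall x, A x -> symexp_pdf (x + c) = k * symexp_pdf x) ->
  tau (translation c @^-1` A) = (k%:E * tau A)%E.
Proof.
move=> mA k0 kA.
have mpdf : measurable_fun A (fun x : MR => (symexp_pdf x)%:E).
  by apply/measurable_EFinP/measurable_funTS; exact: measurable_symexp_pdf.
rewrite /symexp_prob -ge0_integralZl//; last first.
  by move=> x _; rewrite lee_fin symexp_pdf_ge0.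
rewrite [RHS](_ : _ = \int[pushforward leb (translation c)]_(x in A)
    (k%:E * (symexp_pdf x)%:E))%E; last first.
  by apply: eq_measure_integral => B mB _; exact/esym/lebesgue_measure_translation.
rewrite ge0_integral_pushforward//; last 2 first.
- exact: emeasurable_funM.
- by move=> x _; rewrite -EFinM lee_fin mulr_ge0// symexp_pdf_ge0.
apply: eq_integral => x; rewrite inE /= => Ax.
by rewrite -EFinM -kA// /translation subrK.
Qed.

(** One unit step towards the median of [tau], along which the increments of
    the transport map are controlled. *)
Definition soft_threshold (x : MR) : MR := (x : R) - Num.max (-1) (Num.min 1 x).
Local Notation T := soft_threshold.

Lemma soft_threshold_ge1 x : 1 <= x -> T x = x - 1.
Proof. by move=> x1; rewrite /T (min_idPl x1) (max_idPr _)//; lra. Qed.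

Lemma soft_threshold_leN1 x : x <= -1 -> T x = x + 1.
Proof.
move=> x1; rewrite /T (@min_r _ _ 1); last lra.
by rewrite (max_idPl x1) opprK.
Qed.

Lemma soft_threshold0 x : -1 <= x <= 1 -> T x = 0.
Proof.
by move=> /andP[x1 x2]; rewrite /T (min_idPr x2) (max_idPr x1) subrr.
Qed.

Variant soft_threshold_spec (x : R) : R -> Type :=
| SoftThresholdPos of 1 < x : soft_threshold_spec x (x - 1)
| SoftThresholdNeg of x < -1 : soft_threshold_spec x (x + 1)
| SoftThresholdMid of -1 <= x <= 1 : soft_threshold_spec x 0.

Lemma soft_thresholdP x : soft_threshold_spec x (T x).
Proof.
have [x1|x1] := leP x 1; last by rewrite soft_threshold_ge1 1?ltW//; constructor.
have [xN1|xN1] := leP (-1) x.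
  by rewrite soft_threshold0; [constructor|]; apply/andP.
by rewrite soft_threshold_leN1 1?ltW//; constructor.
Qed.

Lemma measurable_soft_threshold : measurable_fun [set: MR] T.
Proof.
apply: measurable_funB => //; apply: measurable_maxr => //.
by apply: measurable_minr.
Qed.

HB.instance Definition _ :=
  @isMeasurableFun.Build _ _ _ _ soft_threshold measurable_soft_threshold.

(** Conditionally on [|X| > 1], the point [T X] has the law of [X]; the
    remaining mass is sent to [0], hence the hypothesis on [A]. *)
Lemma symexp_prob_soft_threshold (A : set MR) : measurable A -> ~ A 0 ->
  tau (T @^-1` A) = ((expR (-1))%:E * tau A)%E.
Proof.
move=> mA A0.
have mP : measurable (A `&` `]0, +oo[%classic) by exact: measurableI.
have mN : measurable (A `&` `]-oo, 0[%classic) by exact: measurableI.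
have AE : A = (A `&` `]0, +oo[%classic) `|` (A `&` `]-oo, 0[%classic).
  rewrite -setIUr; apply/seteqP; split => [x Ax|x []//]; split => //=.
  rewrite !in_itv/= andbT; have [||x0] := ltgtP x 0; [by right|by left|].
  by rewrite x0 in Ax.
have TE : T @^-1` A = (translation 1 @^-1` (A `&` `]0, +oo[%classic)) `|`
                      (translation (-1) @^-1` (A `&` `]-oo, 0[%classic)).
  apply/seteqP; split => x /=; rewrite /translation !in_itv/= andbT opprK.
    case: soft_thresholdP => // x1 Ax; [left|right]; split => //; lra.
  by case=> -[Ax x1]; case: soft_thresholdP => //; lra.
have mS c B : measurable B -> measurable (translation c @^-1` B).
  by move=> mB; rewrite -[X in measurable X]setTI; exact: measurable_translation.
rewrite TE [in RHS]AE !measureU//=; first last.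
- by apply/seteqP; split => x //= -[[_]] + [_]; rewrite /translation !in_itv/=; lra.
- exact: mS.
- exact: mS.
- by apply/seteqP; split => x //= -[[_]] + [_]; rewrite /translation !in_itv/=; lra.
rewrite muleDr//; last by rewrite ge0_adde_def// inE measure_ge0.
congr (_ + _)%E; apply: symexp_prob_translation => //; rewrite ?expR_ge0//.
- move=> x /= [_]; rewrite in_itv/= andbT /symexp_pdf => x0.
  by rewrite !ger0_norm; [|lra|lra]; rewrite mulrA -expRD; congr (expR _ / _); lra.
- move=> x /= [_]; rewrite in_itv/= /symexp_pdf => x0.
  by rewrite !ltr0_norm; [|lra|lra]; rewrite mulrA -expRD; congr (expR _ / _); lra.
Qed.

Lemma integral_soft_threshold (J : MR -> R) : measurable_fun setT J ->
  (forall x, 0 <= J x) -> J 0 = 0 ->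
  (\int[tau]_x (J (T x))%:E = (expR (-1))%:E * \int[tau]_x (J x)%:E)%E.
Proof.
move=> mJ J0 J00.
have mE : measurable_fun setT (EFin \o J) by exact/measurable_EFinP.
have E0 x : (0 <= (EFin \o J) x)%E by rewrite lee_fin.
pose D : set MR := ~` [set 0].
have mD : measurable D by apply: measurableC.
have off (m : {measure set MR -> \bar R}) :
    (\int[m]_x (J x)%:E = \int[m]_(x in D) (J x)%:E)%E.
  rewrite [RHS]integral_mkcond; apply: eq_integral => x _; rewrite patchE.
  by case: ifPn => //; rewrite notin_setE /D /= => /contrapT ->; rewrite J00.
have -> : (\int[tau]_x (J (T x))%:E = \int[pushforward tau T]_x (J x)%:E)%E.
  rewrite (ge0_integral_pushforward measurable_soft_threshold)// => y _.
  by rewrite lee_fin.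
have k0 : 0 <= expR (-1) :> R by exact: expR_ge0.
rewrite (off (pushforward tau (T : {mfun MR >-> MR}))).
rewrite [RHS](_ : _ = \int[mscale (NngNum k0) tau]_(x in D) (J x)%:E)%E; last first.
  rewrite ge0_integral_mscale//= -?off//; first exact: measurable_funTS.
  by move=> x _; rewrite lee_fin.
apply: eq_measure_integral => A mA AD.
rewrite /= /mscale /= -symexp_prob_soft_threshold//.
by move=> A0; exact: (AD 0 A0).
Qed.

(** Integrating the hypothesis and using [integral_soft_threshold] gives
    [I <= 3 / (2 e) * I + E], with [3 / (2 e) <= 3 / 4].  To be allowed to
    subtract, one applies this to the truncations of [J], which satisfy the same
    inequality because [1 <= 3 / 2], and then passes to the limit. *)
Lemma exponential_hardy (J E : MR -> R) :
  measurable_fun setT J -> measurable_fun setT E ->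
  (forall x, 0 <= J x) -> (forall x, 0 <= E x) -> J 0 = 0 ->
  (forall x, J x <= 3 / 2 * J (T x) + E x) ->
  (\int[tau]_x (J x)%:E <= 4%:E * \int[tau]_x (E x)%:E)%E.
Proof.
move=> mJ mE J0 E0 J00 JE.
have mT := measurable_soft_threshold.
pose Jn n (x : MR) : R := Num.min (J x) n%:R.
have mJn n : measurable_fun setT (Jn n) by exact: measurable_minr.
have Jn0 n x : 0 <= Jn n x by rewrite /Jn le_min J0 ler0n.
have bound n : (\int[tau]_x (Jn n x)%:E <= 4%:E * \int[tau]_x (E x)%:E)%E.
  have Jn00 : Jn n 0 = 0 by rewrite /Jn J00 min_l.
  have step x : Jn n x <= 3 / 2 * Jn n (T x) + E x.
    rewrite /Jn; have := JE x; have := E0 x; have := J0 (T x).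
    have : 0 <= n%:R :> R by exact: ler0n.
    by rewrite /Num.min; case: ifP; case: ifP; lra.
  have fin : (\int[tau]_x (Jn n x)%:E < +oo)%E.
    apply: (@le_lt_trans _ _ (\int[tau]_x (cst n%:R%:E x))%E).
      apply: ge0_le_integral => //.
      - by move=> x _; rewrite lee_fin.
      - exact/measurable_EFinP.
      - by move=> x _ /=; rewrite lee_fin /Jn ge_min lexx orbT.
    by rewrite integral_cst//= probability_setT mule1 ltry.
  have main : (\int[tau]_x (Jn n x)%:E <=
      (3 / 4)%:E * \int[tau]_x (Jn n x)%:E + \int[tau]_x (E x)%:E)%E.
    apply: (@le_trans _ _ (\int[tau]_x ((3 / 2)%:E * (Jn n (T x))%:E + (E x)%:E))%E).
      apply: ge0_le_integral => //.
      - by move=> x _; rewrite lee_fin.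
      - exact/measurable_EFinP.
      - apply: emeasurable_funD; last exact/measurable_EFinP.
        apply: emeasurable_funM => //; apply/measurable_EFinP.
        exact: (measurableT_comp (mJn n) mT).
      - by move=> x _; rewrite -EFinM -EFinD lee_fin.
    have mJnT : measurable_fun setT (fun x => (Jn n (T x))%:E).
      by apply/measurable_EFinP; exact: (measurableT_comp (mJn n) mT).
    rewrite ge0_integralD//; last 4 first.
    - by move=> x _; rewrite -EFinM lee_fin mulr_ge0.
    - by apply: emeasurable_funM.
    - by move=> x _; rewrite lee_fin.
    - exact/measurable_EFinP.
    rewrite ge0_integralZl//; last by move=> x _; rewrite lee_fin.
    rewrite integral_soft_threshold// muleA leeD2r//.
    apply: lee_wpmul2r; first by apply: integral_ge0 => x _; rewrite lee_fin.
    by rewrite -EFinM lee_fin; have := @expRN1_le R; lra.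
  have : (0 <= \int[tau]_x (E x)%:E)%E by apply: integral_ge0 => x _; rewrite lee_fin.
  have : (0 <= \int[tau]_x (Jn n x)%:E)%E by apply: integral_ge0 => x _; rewrite lee_fin.
  move: fin main.
  case: (\int[tau]_x (Jn n x)%:E)%E => [a||]//; case: (\int[tau]_x (E x)%:E)%E => [b||]//.
    by move=> _; rewrite -!EFinM -EFinD !lee_fin; lra.
  by move=> *; rewrite mulry gtr0_sg// mul1e leey.
have -> : (\int[tau]_x (J x)%:E = limn (fun n => \int[tau]_x (Jn n x)%:E))%E.
  rewrite -monotone_convergence//.
  - apply: eq_integral => x _; apply/esym/cvg_lim => //.
    apply: cvg_near_cst; near=> n; rewrite /Jn min_l//.
    by near: n; exact: nbhs_infty_ger.
  - by move=> n; exact/measurable_EFinP.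
  - by move=> n x _; rewrite lee_fin.
  - move=> x _ m n mn; rewrite lee_fin /Jn le_min !ge_min lexx/=.
    by rewrite ler_nat mn orbT.
apply: lime_le; last by near=> n; exact: bound.
apply: ereal_nondecreasing_is_cvgn => m n mn; apply: ge0_le_integral => //.
- by move=> x _; rewrite lee_fin.
- exact/measurable_EFinP.
- exact/measurable_EFinP.
- move=> x _; rewrite lee_fin /Jn le_min !ge_min lexx/=.
  by rewrite ler_nat mn orbT.
Unshelve. all: by end_near. Qed.

(** An instance of [exponential_hardy]: one step multiplies [expR (`|x| / 3)] by
    [expR (1 / 3) <= 3 / 2]. *)
Lemma symexp_exponential_moment :
  (\int[tau]_x (expR (`|x| / 3))%:E <= 3%:E)%E.
Proof.
have mE : measurable_fun setT (fun x : MR => expR (`|x| / 3)).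
  by apply: measurableT_comp => //; exact: measurable_funM.
have e1 (x : R) : 1 <= expR (`|x| / 3).
  by rewrite -expR0 ler_expR divr_ge0.
have H : (\int[tau]_x (expR (`|x| / 3) - 1)%:E <=
          4%:E * \int[tau]_x ((1 / 2 : R)%:E))%E.
  apply: (@exponential_hardy _ (fun=> 1 / 2)).
  - exact: measurable_funB.
  - exact: measurable_cst.
  - by move=> x; rewrite subr_ge0.
  - by move=> _; lra.
  - by rewrite normr0 mul0r expR0 subrr.
  move=> x; have h := @expR_onethird_le R.
  have step (u v : R) : u = 1 / 3 + v / 3 ->
      expR u - 1 <= 3 / 2 * (expR (v / 3) - 1) + 1 / 2.
    by move=> ->; rewrite expRD; have := expR_gt0 (v / 3); nra.
  case: soft_thresholdP => x1; [apply: step|apply: step|].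
  - by rewrite !ger0_norm; lra.
  - by rewrite ltr0_norm ?ler0_norm; lra.
  - rewrite normr0 mul0r expR0; suff : expR (`|x| / 3) <= expR (1 / 3) by lra.
    by rewrite ler_expR; have : `|x| <= 1 by [rewrite ler_norml]; lra.
have -> : (\int[tau]_x (expR (`|x| / 3))%:E =
    \int[tau]_x (1%:E + (expR (`|x| / 3) - 1)%:E))%E.
  by apply: eq_integral => x _; rewrite -EFinD addrC subrK.
have c1 (c : R) : (\int[tau]_x c%:E = c%:E)%E.
  by rewrite (integral_cst tau measurableT c%:E)/= probability_setT mule1.
rewrite ge0_integralD//; last by apply/measurable_EFinP; exact: measurable_funB.
move: H; rewrite c1 -EFinM => H.
have h1 : (\int[tau]_x (1 : R)%:E <= 1%:E)%E by rewrite c1.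
by apply: (le_trans (leeD h1 H)); rewrite -EFinD lee_fin; lra.
Qed.

End memoryless.

(** * Distribution functions and the transport map *)

Lemma klipschitz_dist {R : realType} (g : R -> R) (l x y : R) :
  l.-lipschitz g -> `|g x - g y| <= l * `|x - y|.
Proof. by move=> /(_ (x, y)); exact. Qed.

Lemma klipschitz_continuous {R : realType} (g : R -> R) (l : R) :
  l.-lipschitz g -> continuous g.
Proof.
move=> gl x; apply/cvgrPdist_le => e e0; near=> y.
apply: le_trans (klipschitz_dist _ _ gl) _.
have k0 : 0 < `|l| + 1 by rewrite ltr_wpDl.
apply: (@le_trans _ _ ((`|l| + 1) * `|x - y|)).
  by apply: ler_wpM2r => //; have := ler_norm l; lra.
rewrite -ler_pdivlMl// mulrC; near: y.
by apply: cvgr_dist_le => //; rewrite divr_gt0.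
Unshelve. all: by end_near. Qed.

Section cdf_facts.
Context {R : realType}.
Local Notation MR := (measurableTypeR R).
Implicit Type P : probability MR R.

Let idMR : MR -> R := idfun.
#[local] HB.instance Definition _ :=
  @isMeasurableFun.Build _ _ _ _ idMR (@measurable_id _ _ setT).

Lemma distr_fun_fin_num P x : distr_fun P x \is a fin_num.
Proof. exact: fin_num_measure. Qed.

Lemma distr_fun_nondecreasing P x y : x <= y -> (distr_fun P x <= distr_fun P y)%E.
Proof. exact: (@cdf_nondecreasing _ _ _ P (idMR : {RV P >-> R})). Qed.

Lemma distr_fun_gt P u : (u < 1)%E -> exists x, (u < distr_fun P x)%E.
Proof.
move=> u1; apply: contrapT => h; move: u1; apply/negP; rewrite -leNgt.
have := @cvg_cdfy1 _ _ _ P (idMR : {RV P >-> R}).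
apply: cvge_le; apply: nearW => x; rewrite leNgt; apply/negP => ux.
by apply: h; exists x.
Qed.

Lemma distr_fun_lt P u : (0 < u)%E -> exists x, (distr_fun P x < u)%E.
Proof.
move=> u0; apply: contrapT => h; move: u0; apply/negP; rewrite -leNgt.
have := @cvg_cdfNy0 _ _ _ P (idMR : {RV P >-> R}).
apply: cvge_ge; apply: nearW => x; rewrite leNgt; apply/negP => ux.
by apply: h; exists x.
Qed.

Lemma distr_fun_ge_right P u x :
  (forall y, x < y -> (u <= distr_fun P y)%E) -> (u <= distr_fun P x)%E.
Proof.
move=> h; have := @cdf_right_continuous _ _ _ P (idMR : {RV P >-> R}) x.
by apply: cvge_ge; near=> y; apply: h; near: y; exact: nbhs_right_gt.
Unshelve. all: by end_near. Qed.

Lemma measure_itvoc (m : {measure set MR -> \bar R}) a b : a <= b ->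
  (m `]-oo, b]%classic < +oo)%E ->
  (m `]a, b]%classic = m `]-oo, b]%classic - m `]-oo, a]%classic)%E.
Proof.
move=> ab mb; have -> : `]a, b]%classic = `]-oo, b] `\` `]-oo, a] :> set MR.
  by rewrite -[RHS]setCK setCD setCitvl setUC -[LHS]setCK setCitv.
by rewrite measureD ?setIidr//; exact: subset_itvl.
Qed.

Lemma probability_itvoc P a b : a <= b ->
  (P `]a, b]%classic = distr_fun P b - distr_fun P a)%E.
Proof. by move=> ab; apply: measure_itvoc => //; rewrite -ge0_fin_numE// fin_num_measure. Qed.

Lemma eq_measure_ray P (m : {measure set MR -> \bar R}) :
  (forall x, P `]-oo, x]%classic = m `]-oo, x]%classic) ->
  forall A, measurable A -> P A = m A.
Proof.
move=> Pm A; apply: (@measure_unique _ R MR (@ocitv R)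
  (fun k => `](- k%:R), k%:R]%classic) _ _ _ _ P m) => //.
- exact: ocitvI.
- by move=> i; exact: is_ocitv.
- exact: bigcup_itvT.
- move=> _ [[a b] _ <-] /=.
  have [ab|ba] := leP a b; last by rewrite set_itv_ge ?measure0// bnd_simp -leNgt ltW.
  have Pb : (P `]-oo, b]%classic < +oo)%E by rewrite -ge0_fin_numE// fin_num_measure.
  by rewrite !measure_itvoc// -?Pm.
- by move=> k; rewrite -ge0_fin_numE// fin_num_measure.
Qed.

End cdf_facts.

Section symexp_cdf.
Context {R : realType}.
Local Notation leb := (@lebesgue_measure R).
Local Notation tau := (@symexp_prob R).
Local Notation MR := (measurableTypeR R).

Lemma symexp_prob_le_itv (a b : R) : a <= b ->
  (tau `]a, b]%classic <= (b - a)%:E)%E.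
Proof.
move=> ab; rewrite /symexp_prob.
apply: (@le_trans _ _ (\int[leb]_(x in `]a, b]) (cst 1%:E x))%E).
  apply: ge0_le_integral => //.
  - by move=> x _; rewrite lee_fin symexp_pdf_ge0.
  - by apply/measurable_EFinP/measurable_funTS; exact: measurable_symexp_pdf.
  - move=> x _ /=; rewrite lee_fin /symexp_pdf.
    have : expR (- `|x|) <= 1 by rewrite -expR0 ler_expR oppr_le0.
    lra.
rewrite integral_cst//= mul1e lebesgue_measure_itv/= lte_fin.
by case: ifPn => // _; rewrite lee_fin subr_ge0.
Qed.

Lemma symexp_prob_itv_ge (a b m : R) : a <= b -> `|a| <= m -> `|b| <= m ->
  ((expR (- m) / 2 * (b - a))%:E <= tau `]a, b]%classic)%E.
Proof.
move=> ab am bm; rewrite /symexp_prob.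
apply: (@le_trans _ _ (\int[leb]_(x in `]a, b]) (cst (expR (- m) / 2)%:E x))%E).
  rewrite integral_cst//= lebesgue_measure_itv/= lte_fin EFinM.
  case: ltP => // ba; rewrite (_ : b = a) ?subrr//; first by apply/le_anti; rewrite ab ba.
apply: ge0_le_integral => //.
- by move=> x _ /=; rewrite lee_fin divr_ge0 ?expR_ge0.
- by apply/measurable_EFinP/measurable_funTS; exact: measurable_symexp_pdf.
- move=> x /=; rewrite in_itv/= => /andP[ax xb]; rewrite lee_fin /symexp_pdf.
  rewrite ler_pM2r ?invr_gt0// ler_expR lerN2.
  move: am bm; rewrite !ler_norml => /andP[? ?] /andP[? ?]; apply/andP; split; lra.
Qed.

Lemma symexp_distr_fun_lt (a b : R) : a < b ->
  (distr_fun tau a < distr_fun tau b)%E.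
Proof.
move=> ab; rewrite -sube_gt0 -probability_itvoc ?ltW//.
have := @symexp_prob_itv_ge a b (`|a| + `|b|) (ltW ab).
rewrite lerDl normr_ge0 lerDr normr_ge0 => /(_ isT isT); apply: lt_le_trans.
by rewrite lte_fin mulr_gt0 ?divr_gt0 ?expR_gt0 ?subr_gt0.
Qed.

Let cdf (x : R) := fine (distr_fun tau x).

Let cdf_lipschitz x y : x <= y -> 0 <= cdf y - cdf x <= y - x.
Proof.
move=> xy; have := symexp_prob_le_itv xy; rewrite probability_itvoc//.
have := distr_fun_nondecreasing tau xy; rewrite /cdf.
have := distr_fun_fin_num tau x; have := distr_fun_fin_num tau y.
case: (distr_fun tau x) => // a; case: (distr_fun tau y) => // b _ _.
by rewrite -EFinB !lee_fin /= subr_ge0 => -> ->.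
Qed.

Let cdf_continuous : continuous cdf.
Proof.
apply: (@klipschitz_continuous _ _ 1) => -[x y] _ /=; rewrite mul1r.
have [xy|/ltW xy] := leP x y.
  rewrite distrC (distrC x) !ger0_norm; have := cdf_lipschitz xy; lra.
by rewrite !ger0_norm; have := cdf_lipschitz xy; lra.
Qed.

(** The probability integral transform.  For [u] strictly between [0] and [1],
    continuity yields a point where the distribution function equals [u], and
    strict monotonicity identifies the sublevel set with a half-line. *)
Lemma symexp_distr_fun_uniform (u : \bar R) : (0 <= u <= 1)%E ->
  tau [set x : MR | (distr_fun tau x <= u)%E] = u.
Proof.
move=> /andP[u0 u1].
have [->|u_neq0] := eqVneq u 0%E.
  rewrite (_ : [set _ | _] = set0) ?measure0//.
  apply/seteqP; split => // x /= h.
  have := @symexp_distr_fun_lt (x - 1) x; rewrite ltrBlDr ltrDl ltr01.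
  move=> /(_ isT) /lt_le_trans /(_ h); rewrite ltNge measure_ge0//.
have [->|u_neq1] := eqVneq u 1%E.
  rewrite (_ : [set _ | _] = setT) ?probability_setT//.
  by apply/seteqP; split => // x _ /=; exact: probability_le1.
have {u_neq0}u0 : (0 < u)%E by rewrite lt0e u_neq0.
have {u_neq1}u1 : (u < 1)%E by rewrite lt_neqAle u_neq1.
have [b ub] := distr_fun_gt tau u1.
have [a ua] := distr_fun_lt tau u0.
have ab : a <= b.
  rewrite leNgt; apply/negP => /ltW /(distr_fun_nondecreasing tau).
  by rewrite leNgt (lt_trans ua ub).
have [s _ su] : exists2 c, c \in `[a, b] & cdf c = fine u.
  apply: IVT => //; first exact: continuous_subspaceT.
  have fu : u \is a fin_num by rewrite ge0_fin_numE ?ltW// (lt_trans u1) ?ltry.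
  have h1 : cdf a <= fine u by apply: fine_le; rewrite ?distr_fun_fin_num// ltW.
  have h2 : fine u <= cdf b by apply: fine_le; rewrite ?distr_fun_fin_num// ltW.
  by rewrite ge_min le_max h1 h2 orbT.
have {}su : distr_fun tau s = u.
  rewrite -(fineK (distr_fun_fin_num tau s)) -[RHS]fineK; first by congr EFin.
  by rewrite ge0_fin_numE ?ltW// (lt_trans u1) ?ltry.
rewrite -[RHS]su /distr_fun; congr (tau _); apply/seteqP; split => x /=.
  rewrite in_itv/= leNgt => h; rewrite leNgt; apply/negP => /symexp_distr_fun_lt.
  by rewrite su; exact/negP.
by rewrite in_itv/= => xs; rewrite -su; exact: distr_fun_nondecreasing.
Qed.

Lemma symexp_distr_fun_gt0 (x : R) : (0 < distr_fun tau x)%E.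
Proof.
have h : x - 1 < x by lra.
by apply: le_lt_trans (symexp_distr_fun_lt h).
Qed.

Lemma symexp_distr_fun_lt1 (x : R) : (distr_fun tau x < 1)%E.
Proof.
have h : x < x + 1 by lra.
by apply: lt_le_trans (symexp_distr_fun_lt h) _; exact: probability_le1.
Qed.

End symexp_cdf.

Section transport.
Context {R : realType}.
Local Notation tau := (@symexp_prob R).
Local Notation MR := (measurableTypeR R).
Variable mu : probability MR R.
Local Notation U := (transport_map mu : MR -> MR).

(** The Galois connection between a distribution function and its quantile
    function.  The infimum is a real number because the distribution function
    of [tau] avoids [0] and [1], and it is attained by right continuity. *)
Lemma transport_map_le (x y : R) :
  (transport_map mu x <= y) = (distr_fun tau x <= distr_fun mu y)%E.
Proof.
pose S := [set z : R | (distr_fun tau x <= distr_fun mu z)%E].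
have S0 : S !=set0.
  have [z xz] := distr_fun_gt mu (symexp_distr_fun_lt1 x).
  by exists z; exact: ltW.
have Slb : has_lbound S.
  have [z zx] := distr_fun_lt mu (symexp_distr_fun_gt0 x).
  exists z => w /= xw; rewrite leNgt; apply/negP => wz.
  have := le_trans xw (distr_fun_nondecreasing mu (ltW wz)).
  by rewrite leNgt zx.
rewrite /transport_map /quantile ereal_inf_EFin//=.
apply/idP/idP => [Sy|xy]; last exact: ge_inf.
apply: distr_fun_ge_right => z yz.
have [w /= xw wz] := inf_lt S0 (le_lt_trans Sy yz).
exact: le_trans xw (distr_fun_nondecreasing mu (ltW wz)).
Qed.

Lemma transport_map_nondecreasing (x y : R) : x <= y ->
  transport_map mu x <= transport_map mu y.
Proof.
move=> xy; rewrite transport_map_le.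
apply: le_trans (distr_fun_nondecreasing tau xy) _.
by rewrite -transport_map_le.
Qed.

Lemma measurable_transport_map : measurable_fun [set: MR] U.
Proof.
apply: nondecreasing_measurable => // x y; exact: transport_map_nondecreasing.
Qed.

HB.instance Definition _ :=
  @isMeasurableFun.Build _ _ _ _ U measurable_transport_map.

Lemma pushforward_transport_map (A : set MR) : measurable A ->
  mu A = pushforward tau U A.
Proof.
move=> mA; apply: (@eq_measure_ray _ mu (pushforward tau (U : {mfun MR >-> MR}))) => // x.
rewrite /= /pushforward.
rewrite (_ : _ @^-1` _ = [set y | (distr_fun tau y <= distr_fun mu x)%E]); last first.
  by apply/seteqP; split => y /=; rewrite in_itv/= transport_map_le.
by rewrite symexp_distr_fun_uniform//; apply/andP; split => //; exact: probability_le1.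
Qed.

Lemma ge0_integral_transport_map (f : MR -> \bar R) :
  measurable_fun setT f -> (forall x, 0 <= f x)%E ->
  (\int[mu]_x f x = \int[tau]_x f (transport_map mu x))%E.
Proof.
move=> mf f0.
rewrite -(ge0_integral_pushforward measurable_transport_map tau measurableT mf);
  last by move=> y _; exact: f0.
apply: (@eq_measure_integral _ MR R setT (pushforward tau (U : {mfun MR >-> MR})) mu) => A mA _.
exact: pushforward_transport_map.
Qed.

End transport.

(** * The gradient of a convex Lipschitz function *)

Section convex_gradient.
Context {R : realType}.
Variables (g : R -> R) (l : R).
Hypotheses (gconv : convex_on_line g) (glip : l.-lipschitz g).

Let slope x y := (g y - g x) / (y - x).

Lemma convex_on_line_chord (x y z : R) : x < y -> y < z ->
  (z - x) * g y <= (z - y) * g x + (y - x) * g z.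
Proof.
move=> xy yz; have zx : 0 < z - x by lra.
pose t := (y - x) / (z - x).
have t01 : 0 <= t <= 1.
  by rewrite /t divr_ge0 ?ler_pdivrMr//; lra.
have zx0 : z - x != 0 by rewrite gt_eqF.
pose t01i := Itv01 (proj1 (andP t01)) (proj2 (andP t01)).
have cE : conv t01i (z : R^o) (x : R^o) = y.
  by rewrite convRE /= /unstable.onem /t; field.
have : g (conv t01i (z : R^o) (x : R^o)) <= t * g z + (1 - t) * g x.
  exact: (gconv t01i (in_setT z) (in_setT x)).
rewrite cE => /(ler_wpM2l (ltW zx)) /le_trans; apply.
by rewrite le_eqVlt; apply/orP; left; apply/eqP; rewrite /t; field.
Qed.

Let slope_l x y : x != y -> `|slope x y| <= l.
Proof.
move=> xy; rewrite /slope normrM normfV ler_pdivrMr ?normr_gt0 ?subr_eq0 1?eq_sym//.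
exact: klipschitz_dist.
Qed.

Let slopeC x y : slope x y = slope y x.
Proof. by rewrite /slope -(opprB (g x)) -(opprB x y) invrN mulrNN. Qed.

Let slope_le3 x y z : x < y -> y < z -> slope x y <= slope x z <= slope y z.
Proof.
move=> xy yz; have := convex_on_line_chord xy yz; rewrite /slope => h.
have [h1 h2 h3] : [/\ 0 < y - x, 0 < z - y & 0 < z - x] by split; lra.
apply/andP; split; rewrite ler_pdivrMr// mulrAC ler_pdivlMr//; lra.
Qed.

Local Notation a := (left_derivative g).
Local Notation b := (right_derivative g).

Let cvg_right x : slope x y @[y --> x^'+] --> b x.
Proof.
apply: nondecreasing_at_right_is_cvgr.
  near=> r => y z; rewrite !in_itv/= => /andP[xy _] /andP[xz _].
  by rewrite le_eqVlt => /predU1P[->//|yz]; have /andP[] := slope_le3 xy yz.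
near=> r; exists (- l) => _ [y /= + <-]; rewrite in_itv/= => /andP[xy _].
by have := slope_l (negbT (lt_eqF xy)); rewrite ler_norml => /andP[].
Unshelve. all: by end_near. Qed.

Let cvg_left x : slope x y @[y --> x^'-] --> a x.
Proof.
apply: nondecreasing_at_left_is_cvgr.
  near=> r => y z; rewrite !in_itv/= => /andP[_ yx] /andP[_ zx].
  rewrite le_eqVlt => /predU1P[->//|yz]; have /andP[] := slope_le3 yz zx.
  by rewrite (slopeC x) (slopeC x).
near=> r; exists l => _ [y /= + <-]; rewrite in_itv/= => /andP[_ yx].
by have := slope_l (negbT (gt_eqF yx)); rewrite ler_norml => /andP[].
Unshelve. all: by end_near. Qed.

Let right_le x y : x < y -> b x <= slope x y.
Proof.
move=> xy; apply: limr_le; first by apply: cvgP; exact: cvg_right.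
near=> z; have xz : x < z by near: z; exact: nbhs_right_gt.
have zy : z < y by near: z; exact: nbhs_right_lt.
by have /andP[] := slope_le3 xz zy.
Unshelve. all: by end_near. Qed.

Let left_ge x y : y < x -> slope y x <= a x.
Proof.
move=> yx; apply: limr_ge; first by apply: cvgP; exact: cvg_left.
near=> z; have xz : z < x by near: z; exact: nbhs_left_lt.
have zy : y < z by near: z; exact: nbhs_left_gt.
by have /andP[_] := slope_le3 zy xz; rewrite (slopeC z).
Unshelve. all: by end_near. Qed.

Let left_le_right x : a x <= b x.
Proof.
apply: limr_ge; first (by apply: cvgP; exact: cvg_right); near=> z.
have xz : x < z by near: z; exact: nbhs_right_gt.
apply: limr_le; first (by apply: cvgP; exact: cvg_left); near=> y.
have yx : y < x by near: y; exact: nbhs_left_lt.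
have /andP[h1 h2] := slope_le3 yx xz; rewrite -/(slope x y) slopeC; exact: le_trans h1 h2.
Unshelve. all: by end_near. Qed.

Let right_le_left x y : x < y -> b x <= a y.
Proof. by move=> xy; apply: le_trans (right_le xy) (left_ge xy). Qed.

Let right_nd x y : x <= y -> b x <= b y.
Proof.
rewrite le_eqVlt => /predU1P[->//|xy].
exact: le_trans (right_le_left xy) (left_le_right y).
Qed.

Let left_nd x y : x <= y -> a x <= a y.
Proof.
rewrite le_eqVlt => /predU1P[->//|xy].
exact: le_trans (left_le_right x) (right_le_left xy).
Qed.

Let left_geNl x : - l <= a x.
Proof.
have xx : x - 1 < x by lra.
apply: le_trans (left_ge xx).
by have := slope_l (negbT (lt_eqF xx)); rewrite ler_norml => /andP[].
Qed.

Let right_le_l x : b x <= l.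
Proof.
have xx : x < x + 1 by lra.
apply: le_trans (right_le xx) _.
by have := slope_l (negbT (lt_eqF xx)); rewrite ler_norml => /andP[].
Qed.

(** The distance from [0] to the interval between the one-sided derivatives. *)
Lemma convex_abs_gradE x :
  abs_grad g x = Num.max 0 (Num.max (a x) (- b x)).
Proof.
have ab := left_le_right x.
set m := Num.max _ _; rewrite /abs_grad; set S := [set _ | _ in _].
have m_lb : lbound S m.
  move=> _ [s /= + <-]; rewrite in_itv/= => /andP[s0 s1].
  rewrite /m !ge_max normr_ge0 /= !ler_normr; apply/andP; split.
    by apply/orP; left; nra.
  by apply/orP; right; nra.
have Sm : S m.
  have [a0|a0] := leP 0 (a x).
    exists 1; rewrite /= ?in_itv/= ?ler01 ?lexx// mul1r subrr mul0r addr0.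
    by rewrite ger0_norm// /m (@max_l _ _ (a x)) ?max_r//; lra.
  have [b0|b0] := leP (b x) 0.
    exists 0; rewrite /= ?in_itv/= ?ler01 ?lexx// mul0r subr0 mul1r add0r.
    by rewrite ler0_norm// /m (@max_r _ _ (a x)) ?max_r//; lra.
  exists (b x / (b x - a x)).
    by rewrite /= in_itv/= divr_ge0 ?ler_pdivrMr//; lra.
  have ba : b x - a x != 0 by rewrite gt_eqF//; lra.
  rewrite (_ : _ + _ = 0); last by field.
  by rewrite normr0 /m max_l// ge_max; apply/andP; split; lra.
apply/le_anti/andP; split.
  by apply: ge_inf => //; exists m.
by apply: lb_le_inf => //; exists m.
Qed.

Lemma convex_abs_grad_ge0 x : 0 <= abs_grad g x.
Proof. by rewrite convex_abs_gradE le_max lexx. Qed.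

Lemma convex_abs_grad_le x : abs_grad g x <= l.
Proof.
rewrite convex_abs_gradE !ge_max; apply/and3P.
have := left_geNl x; have := right_le_l x; have := left_le_right x.
by split; lra.
Qed.

(** A one-sided inequality: the gradient at [x], which is computed with the slope
    on the side where [g] decreases, bounds how far below [g x] the function may
    be at any other point. *)
Lemma convex_sub_le_abs_grad x y : g x - g y <= abs_grad g x * `|x - y|.
Proof.
have aD : a x <= abs_grad g x by rewrite convex_abs_gradE !le_max lexx !orbT.
have bD : - b x <= abs_grad g x by rewrite convex_abs_gradE !le_max lexx !orbT.
have [yx|xy|->] := ltgtP y x; last by rewrite !subrr normr0 mulr0.
- have yx0 : 0 < x - y by lra.
  rewrite gtr0_norm//; have := left_ge yx; rewrite /slope ler_pdivrMr// => h.
  by apply: le_trans h _; rewrite ler_pM2r.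
- have yx0 : 0 < y - x by lra.
  rewrite ltr0_norm; last lra.
  have := right_le xy; rewrite /slope ler_pdivlMr// => h.
  by have := ler_wpM2r (ltW yx0) bD; lra.
Qed.

(** The gradient grows away from the minimum, whichever side [x] lies on. *)
Lemma convex_abs_grad_side x :
  (forall y, x <= y -> abs_grad g x <= abs_grad g y) \/
  (forall y, y <= x -> abs_grad g x <= abs_grad g y).
Proof.
have [a0|a0] := leP 0 (a x); [left|right] => y xy; rewrite !convex_abs_gradE.
  rewrite !ge_max !le_max lexx left_nd// !orbT/=.
  by have := left_le_right x; have := left_nd xy => *; apply/orP; left; lra.
rewrite !ge_max !le_max lexx lerN2 right_nd// !orbT/=.
by rewrite andbT; apply/orP; left; exact: ltW.
Qed.

Lemma measurable_convex_abs_grad :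
  measurable_fun [set: measurableTypeR R] (abs_grad g : measurableTypeR R -> R).
Proof.
rewrite (_ : abs_grad g = fun x => Num.max 0 (Num.max (a x) (- b x))); last first.
  by apply/funext => x; exact: convex_abs_gradE.
apply: measurable_maxr => //; apply: measurable_maxr => //.
  by apply: nondecreasing_measurable => // x y; exact: left_nd.
by apply: measurable_funN; apply: nondecreasing_measurable => // x y; exact: right_nd.
Qed.

(** Negation transfers all of the above to concave functions. *)
Lemma abs_gradN x : abs_grad (fun y => - g y) x = abs_grad g x.
Proof.
have aN : left_derivative (fun y => - g y) x = - a x.
  apply/cvg_lim => //; rewrite (_ : (fun y => _) = (fun y => - slope x y)).
    by apply: cvgN; exact: cvg_left.
  by apply/funext => y; rewrite /slope -mulNr opprB opprK addrC.
have bN : right_derivative (fun y => - g y) x = - b x.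
  apply/cvg_lim => //; rewrite (_ : (fun y => _) = (fun y => - slope x y)).
    by apply: cvgN; exact: cvg_right.
  by apply/funext => y; rewrite /slope -mulNr opprB opprK addrC.
rewrite /abs_grad aN bN; congr inf; apply: eq_imagel => s _ /=.
by rewrite !mulrN -opprD normrN.
Qed.

End convex_gradient.

(** * The variational bound on the entropy *)

Lemma mul_ln_ge {R : realType} (z c : R) : 0 < z -> (c + 1) * z - expR c <= z * ln z.
Proof.
move=> z0; have := expR_ge1Dx (c - ln z).
rewrite expRB lnK ?posrE// ler_pdivlMr//; lra.
Qed.

(** [z * ln z] is convex and so lies above its tangent at [expR c], by
    [mul_ln_ge]; when the integral of [expR g] is replaced by this tangent, the
    entropy becomes the integral of a pointwise quantity. *)
Lemma entropy_exp_le_gap {R : realType} (mu : probability (measurableTypeR R) R)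
    (g : R -> R) (c : R) :
  mu.-integrable setT (fun x => (expR (g x))%:E) ->
  mu.-integrable setT (fun x => (g x * expR (g x))%:E) ->
  (entropy_exp mu g <= \int[mu]_x (expR c * entropy_gap (g x - c))%:E)%E.
Proof.
move=> ie ige.
have -> : (\int[mu]_x (expR c * entropy_gap (g x - c))%:E =
  \int[mu]_x ((g x * expR (g x))%:E + ((- (c + 1))%:E * (expR (g x))%:E + (expR c)%:E)))%E.
  apply: eq_integral => x _; rewrite -EFinM -!EFinD; congr EFin.
  rewrite /entropy_gap expRB; have := expR_gt0 c; set e := expR c => e0.
  by field; rewrite gt_eqF.
have ice : mu.-integrable setT (fun x => ((- (c + 1))%:E * (expR (g x))%:E)%E).
  exact: integrableZl.
have ic : mu.-integrable setT (cst (expR c)%:E).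
  exact: finite_measure_integrable_cst.
rewrite integralD//; last exact: integrableD.
rewrite integralD// integralZl//.
rewrite (integral_cst mu measurableT (expR c)%:E)/= probability_setT mule1.
rewrite /entropy_exp.
have := integrable_fin_num measurableT ie.
have := integrable_fin_num measurableT ige.
have : (0 <= \int[mu]_x (expR (g x))%:E)%E.
  by apply: integral_ge0 => x _; rewrite lee_fin expR_ge0.
case: (\int[mu]_x (expR (g x))%:E)%E => [z||]//.
case: (\int[mu]_x (g x * expR (g x))%:E)%E => [m||]// + _ _.
rewrite lee_fin le_eqVlt => /predU1P[<-|z0].
  by rewrite mul0e oppe0 adde0 mule0 add0e -EFinD lee_fin lerDl expR_ge0.
rewrite lne_EFin// -!EFinM -EFinN -!EFinD lee_fin.
have := mul_ln_ge c z0; lra.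
Qed.

(** * Increments of the transport map and moments of the reference law *)

Section increments.
Context {R : realType}.
Local Notation tau := (@symexp_prob R).
Local Notation MR := (measurableTypeR R).
Variables (mu : probability MR R) (h : R).
Hypothesis h_gt0 : 0 < h.
Hypothesis hU : forall x, transport_map mu (x + 1) - transport_map mu x <= h.
Local Notation U := (transport_map mu).
Local Notation T := (@soft_threshold R).

Lemma transport_map_soft_threshold x : `|U x - U (T x)| <= h.
Proof.
have key (y z : R) : y <= z -> z <= y + 1 -> 0 <= U z - U y <= h.
  move=> yz zy; rewrite subr_ge0 transport_map_nondecreasing//=.
  apply: le_trans (hU y); apply: lerB => //.
  exact: transport_map_nondecreasing.
case: soft_thresholdP => [x1|x1|/andP[x1 x2]].
- have /andP[? ?] : 0 <= U x - U (x - 1) <= h by apply: key; lra.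
  by rewrite ger0_norm.
- have /andP[? ?] : 0 <= U (x + 1) - U x <= h by apply: key; lra.
  by rewrite distrC ger0_norm.
have [x0|/ltW x0] := leP 0 x.
- have /andP[? ?] : 0 <= U x - U 0 <= h by apply: key; lra.
  by rewrite ger0_norm.
- have /andP[? ?] : 0 <= U 0 - U x <= h by apply: key; lra.
  by rewrite distrC ger0_norm.
Qed.

Lemma transport_map_growth x : `|U x - U 0| <= h * (`|x| + 1).
Proof.
have step n y : U (y + n%:R) - U y <= h * n%:R.
  elim: n => [|n IH]; first by rewrite addr0 subrr mulr0.
  have := hU (y + n%:R); rewrite -addrA -natr1; lra.
have far y z : y <= z -> 0 <= U z - U y <= h * (z - y + 1).
  move=> yz; rewrite subr_ge0 transport_map_nondecreasing//=.
  have zy0 : 0 <= z - y by lra.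
  have := truncn_itv zy0; set n := Num.truncn _ => /andP[n1 n2].
  apply: (@le_trans _ _ (U (y + n.+1%:R) - U y)).
    by apply: lerB => //; apply: transport_map_nondecreasing; lra.
  apply: le_trans (step _ _) _; rewrite ler_pM2l// -natr1; lra.
have [x0|/ltW x0] := leP 0 x.
- by rewrite (ger0_norm x0) ger0_norm; have /andP[] := far _ _ x0; rewrite subr0.
- by rewrite (ler0_norm x0) distrC ger0_norm; have /andP[] := far _ _ x0; rewrite sub0r.
Qed.

End increments.

Section moments.
Context {R : realType}.
Local Notation tau := (@symexp_prob R).
Local Notation MR := (measurableTypeR R).

Lemma symexp_exponential_moment1 :
  (\int[tau]_x (expR ((`|x| + 1) / 3))%:E <= (9 / 2)%:E)%E.
Proof.
have -> : (\int[tau]_x (expR ((`|x| + 1) / 3))%:E =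
  \int[tau]_x ((expR (1 / 3))%:E * (expR (`|x| / 3))%:E))%E.
  by apply: eq_integral => x _; rewrite -EFinM -expRD; congr (expR _)%:E; lra.
rewrite ge0_integralZl//; last first.
  by apply/measurable_EFinP; apply: measurableT_comp => //; exact: measurable_funM.
apply: (@le_trans _ _ ((3 / 2)%:E * 3%:E)%E); last by rewrite -EFinM lee_fin; lra.
apply: lee_pmul.
- by rewrite lee_fin expR_ge0.
- by apply: integral_ge0 => x _; rewrite lee_fin expR_ge0.
- by rewrite lee_fin expR_onethird_le.
- exact: symexp_exponential_moment.
Qed.

Lemma symexp_weighted_moment :
  (\int[tau]_x ((`|x| + 1) ^+ 2 * expR ((`|x| + 1) / 10))%:E <= 113%:E)%E.
Proof.
have mE (k : R) : measurable_fun setT (fun x : MR => expR ((`|x| + 1) / k)).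
  apply: measurableT_comp => //; apply: measurable_funM => //.
  exact: measurable_funD.
apply: (@le_trans _ _ (\int[tau]_x (25%:E * (expR ((`|x| + 1) / 3))%:E))%E).
  apply: ge0_le_integral => //.
  - apply/measurable_EFinP; apply: measurable_funM => //.
    by apply: measurable_funX; exact: measurable_funD.
  - by apply: emeasurable_funM => //; exact/measurable_EFinP.
  - move=> x _; rewrite -EFinM lee_fin.
    by apply: sqr_expR_le; rewrite addr_ge0.
rewrite ge0_integralZl//; last exact/measurable_EFinP.
apply: (@le_trans _ _ (25%:E * (9 / 2)%:E)%E).
  by apply: lee_wpmul2l; [rewrite lee_fin|exact: symexp_exponential_moment1].
by rewrite -EFinM lee_fin; lra.
Qed.

End moments.

(** * The logarithmic Sobolev inequality *)

Section log_sobolev.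
Context {R : realType}.
Local Notation tau := (@symexp_prob R).
Local Notation MR := (measurableTypeR R).
Local Notation phi := (@entropy_gap R).
Local Notation T := (@soft_threshold R).
Variables (mu : probability MR R) (h : R).
Hypothesis h_gt0 : 0 < h.
Hypothesis hU : forall x, transport_map mu (x + 1) - transport_map mu x <= h.
Local Notation U := (transport_map mu).
Variables (g : R -> R) (l : R).
Hypotheses (glip : l.-lipschitz g) (lh : l * h <= 1 / 10) (l_ge0 : 0 <= l).

Let F (x : MR) : R := g (U x) - g (U 0).

Let F_T x : `|F x - F (T x)| <= 1 / 10.
Proof.
rewrite /F opprB addrA subrK.
apply: le_trans (klipschitz_dist _ _ glip) _; apply: le_trans lh.
by apply: ler_wpM2l => //; exact: transport_map_soft_threshold.
Qed.

Let F_growth x : `|F x| <= (`|x| + 1) / 10.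
Proof.
apply: le_trans (klipschitz_dist _ _ glip) _.
apply: le_trans (ler_wpM2l l_ge0 (transport_map_growth h_gt0 hU x)) _.
by rewrite mulrA (mulrC _ 10^-1) -div1r; apply: ler_wpM2r => //; rewrite addr_ge0.
Qed.

Let F0 : F 0 = 0. Proof. by rewrite /F subrr. Qed.

Let measurable_g : measurable_fun [set: MR] (g : MR -> R).
Proof. by apply: continuous_measurable_fun; exact: klipschitz_continuous glip. Qed.

Let measurable_F : measurable_fun setT F.
Proof.
apply: measurable_funB => //.
exact: (measurableT_comp measurable_g (measurable_transport_map mu)).
Qed.

(** Since [g (U x)] grows at rate at most [1 / 10] in [|x|], [2 * |g|] is within
    the range of the exponential moment of rate [1 / 3]; it dominates both
    integrands, since [|t| * expR t <= expR (2 * |t|)]. *)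
Lemma integrable_expR_lipschitz :
  mu.-integrable setT (fun x => (expR (g x))%:E) /\
  mu.-integrable setT (fun x => (g x * expR (g x))%:E).
Proof.
have mexp : measurable_fun [set: MR] (fun x : MR => expR (2 * `|g x|)).
  apply: measurableT_comp => //; apply: measurable_funM => //.
  exact: measurableT_comp.
have ie : mu.-integrable setT (fun x => (expR (2 * `|g x|))%:E).
  apply/integrableP; split; first exact/measurable_EFinP.
  under eq_integral => x _ do rewrite /= ger0_norm ?expR_ge0//.
  rewrite ge0_integral_transport_map//; last exact/measurable_EFinP.
  apply: (@le_lt_trans _ _ (\int[tau]_x ((expR (2 * `|g (U 0)|))%:E *
      (expR ((`|x| + 1) / 3))%:E))%E).
    have mr : measurable_fun setT (fun x : MR => expR ((`|x| + 1) / 3)).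
      apply: measurableT_comp => //; apply: measurable_funM => //.
      exact: measurable_funD.
    apply: ge0_le_integral => //.
    - apply/measurable_EFinP.
      exact: (measurableT_comp mexp (measurable_transport_map mu)).
    - by apply: emeasurable_funM => //; exact/measurable_EFinP.
    - move=> x _; rewrite -EFinM lee_fin -expRD ler_expR.
      have := F_growth x; have := ler_normD (F x) (g (U 0)).
      rewrite /F subrK; have : 0 <= `|x| + 1 by rewrite addr_ge0.
      lra.
  rewrite ge0_integralZl//; last first.
    apply/measurable_EFinP.
    apply: measurableT_comp => //; apply: measurable_funM => //.
    exact: measurable_funD.
  apply: (@le_lt_trans _ _ ((expR (2 * `|g (U 0)|))%:E * (9 / 2)%:E)%E).
    apply: lee_wpmul2l; first by rewrite lee_fin expR_ge0.
    exact: symexp_exponential_moment1.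
  by rewrite -EFinM ltry.
have me : measurable_fun [set: MR] (fun x : MR => expR (g x)).
  exact: measurableT_comp.
split; apply: le_integrable ie => //.
- exact/measurable_EFinP.
- move=> x _ /=; rewrite lee_fin !(ger0_norm (expR_ge0 _)) ler_expR.
  have := ler_norm (g x); have := normr_ge0 (g x); lra.
- by apply/measurable_EFinP; exact: measurable_funM.
- move=> x _ /=; rewrite lee_fin normrM !(ger0_norm (expR_ge0 _)).
  have -> : 2 * `|g x| = `|g x| + `|g x| by lra.
  rewrite expRD; apply: ler_pM; rewrite ?expR_ge0//.
    by have := expR_ge1Dx `|g x|; lra.
  by rewrite ler_expR ler_norm.
Qed.

Section energy.
Variable D : R -> R.
Hypotheses (mD : measurable_fun [set: MR] (D : MR -> R)) (D_ge0 : forall x, 0 <= D x).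
Hypothesis D_side :
  (forall y, U 0 <= y -> D (U 0) <= D y) \/ (forall y, y <= U 0 -> D (U 0) <= D y).

Let I := (\int[tau]_x (D (U x) ^+ 2 * expR (F x))%:E)%E.

Let measurable_energy :
  measurable_fun setT (fun x : MR => D (U x) ^+ 2 * expR (F x)).
Proof.
apply: measurable_funM; last exact: measurableT_comp.
by apply: measurable_funX; exact: (measurableT_comp mD (measurable_transport_map mu)).
Qed.

Let energy_ge0 x : 0 <= D (U x) ^+ 2 * expR (F x).
Proof. by rewrite mulr_ge0 ?sqr_ge0 ?expR_ge0. Qed.

(** The interval has mass at least [1 / 8], and there [expR (F x)] is at least
    [9 / 10], since [T x = 0]; the constant comes from
    [1 / 9 <= 9 / 10 * (1 / 8)]. *)
Let side_le (a b : R) : a <= b -> b - a = 1 -> -1 <= a -> b <= 1 ->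
  (forall x, a < x <= b -> D (U 0) <= D (U x)) ->
  ((D (U 0) ^+ 2)%:E <= 9%:E * I)%E.
Proof.
move=> ab ba1 a1 b1 h0.
have mass : ((1 / 8 : R)%:E <= tau `]a, b]%classic)%E.
  apply: (@le_trans _ _ ((expR (- 1) / 2 * (b - a))%:E)).
    by rewrite lee_fin ba1; have := @expRN1_ge R; lra.
  by apply: symexp_prob_itv_ge => //; rewrite ler_norml; lra.
have e9 : 9 / 10 <= expR (- (1 / 10)) :> R.
  by have := @expR_ge1Dx R (- (1 / 10)); lra.
have low : ((9 / 10 * D (U 0) ^+ 2)%:E * tau `]a, b]%classic <= I)%E.
  rewrite -integral_cst//.
  apply: (@le_trans _ _ (\int[tau]_(x in `]a, b]) (D (U x) ^+ 2 * expR (F x))%:E)%E).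
    apply: ge0_le_integral => //.
    - by move=> x _ /=; rewrite lee_fin mulr_ge0 ?sqr_ge0.
    - by apply/measurable_EFinP; exact: measurable_funTS.
    - move=> x /=; rewrite in_itv/= => xab; rewrite lee_fin mulrC.
      apply: ler_pM; rewrite ?sqr_ge0//.
        by rewrite ler_sqr ?nnegrE//; exact: h0.
      apply: (le_trans e9); rewrite ler_expR.
      have := F_T x; rewrite soft_threshold0; last by move: xab => /andP[]; lra.
      by rewrite F0 subr0 ler_norml => /andP[].
  apply: ge0_subset_integral => //; first exact/measurable_EFinP.
  by move=> x _; rewrite lee_fin.
have : ((9 / 10 * D (U 0) ^+ 2 * (1 / 8))%:E <= I)%E.
  apply: le_trans low; rewrite EFinM; apply: lee_wpmul2l => //.
  by rewrite lee_fin mulr_ge0 ?sqr_ge0.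
case: I => [i||]//.
  by rewrite -EFinM !lee_fin; have := sqr_ge0 (D (U 0)); lra.
by move=> _; rewrite mulry gtr0_sg// mul1e leey.
Qed.

Let base_le : ((D (U 0) ^+ 2)%:E <= 9%:E * I)%E.
Proof.
case: D_side => side.
  apply: (@side_le 0 1); [lra..|].
  by move=> x /andP[x0 _]; apply: side; apply: transport_map_nondecreasing; exact: ltW.
apply: (@side_le (- 1) 0); [lra..|].
by move=> x /andP[_ x0]; apply: side; exact: transport_map_nondecreasing.
Qed.

Let Q (x : MR) : R := (`|x| + 1) ^+ 2 * expR ((`|x| + 1) / 10).

Let measurable_Q : measurable_fun setT Q.
Proof.
apply: measurable_funM; first by apply: measurable_funX; exact: measurable_funD.
apply: measurableT_comp => //; apply: measurable_funM => //; exact: measurable_funD.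
Qed.

Let Q_ge0 x : 0 <= Q x.
Proof. by rewrite mulr_ge0 ?sqr_ge0 ?expR_ge0. Qed.

(** The common part of the convex and concave cases: [D] is the gradient, and
    [phi (F x)] is split into a potential [J], treated by [exponential_hardy],
    and a remainder governed by the gradient at the base point.  The two
    contributions are [4 * 5] and [9 * 113] times [h ^+ 2], far below [2740]. *)
Lemma log_sobolev_of_potential (J : MR -> R) :
  measurable_fun setT J -> (forall x, 0 <= J x) -> J 0 = 0 ->
  (forall x, J x <= 3 / 2 * J (T x) + 5 * (h * D (U x)) ^+ 2 * expR (F x)) ->
  (forall x, phi (F x) <= J x + D (U 0) ^+ 2 * h ^+ 2 * Q x) ->
  (entropy_exp mu g <=
   (2740 * h ^+ 2)%:E * \int[mu]_x (D x ^+ 2 * expR (g x))%:E)%E.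
Proof.
move=> mJ J_ge0 J0 Jstep Fle.
have [ie ige] := integrable_expR_lipschitz.
apply: (le_trans (entropy_exp_le_gap (g (U 0)) ie ige)).
set c := g (U 0).
have mphi : measurable_fun [set: MR] (fun x : MR => phi (g x - c)).
  have mB : measurable_fun [set: MR] (fun x : MR => g x - c) by exact: measurable_funB.
  rewrite /entropy_gap; apply: measurable_funD => //; apply: measurable_funM.
    exact: measurable_funB.
  exact: measurableT_comp.
have ec0 : 0 <= expR c by exact: expR_ge0.
have lhsE : (\int[mu]_x (expR c * phi (g x - c))%:E =
    (expR c)%:E * \int[tau]_x (phi (F x))%:E)%E.
  rewrite -ge0_integralZl//; last 2 first.
  - apply/measurable_EFinP.
    exact: (measurableT_comp mphi (measurable_transport_map mu)).
  - by move=> x _; rewrite lee_fin entropy_gap_ge0.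
  rewrite ge0_integral_transport_map//.
    by apply/measurable_EFinP; exact: measurable_funM.
  by move=> x; rewrite lee_fin mulr_ge0 ?entropy_gap_ge0.
have rhsE : (\int[mu]_x (D x ^+ 2 * expR (g x))%:E = (expR c)%:E * I)%E.
  rewrite /I -ge0_integralZl//; last 2 first.
  - exact/measurable_EFinP.
  - by move=> x _; rewrite lee_fin.
  rewrite ge0_integral_transport_map//.
  - apply: eq_integral => x _; rewrite -EFinM; congr EFin.
    by rewrite /F mulrCA -expRD addrC subrK.
  - apply/measurable_EFinP; apply: measurable_funM; first exact: measurable_funX.
    exact: measurableT_comp.
  - by move=> x; rewrite lee_fin mulr_ge0 ?sqr_ge0 ?expR_ge0.
rewrite lhsE rhsE muleCA; apply: lee_wpmul2l => //.
have I_ge0 : (0 <= I)%E by apply: integral_ge0 => x _; rewrite lee_fin.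
have hJ : (\int[tau]_x (J x)%:E <= (20 * h ^+ 2)%:E * I)%E.
  apply: (@le_trans _ _ (4%:E * \int[tau]_x ((5 * h ^+ 2)%:E *
      (D (U x) ^+ 2 * expR (F x))%:E))%E).
    apply: (@exponential_hardy _ J (fun x => 5 * h ^+ 2 * (D (U x) ^+ 2 * expR (F x)))) => //.
    - exact: measurable_funM.
    - by move=> x; rewrite mulr_ge0 ?energy_ge0// mulr_ge0 ?sqr_ge0.
    - by move=> x; have := Jstep x; rewrite exprMn; lra.
  rewrite ge0_integralZl//; last 3 first.
  - exact/measurable_EFinP.
  - by move=> x _; rewrite lee_fin.
  - by rewrite lee_fin mulr_ge0 ?sqr_ge0.
  rewrite muleA -EFinM; apply: lee_wpmul2r => //.
  by rewrite lee_fin mulrA; have := sqr_ge0 h; lra.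
have hQ : (\int[tau]_x (D (U 0) ^+ 2 * h ^+ 2 * Q x)%:E <=
    (1017 * h ^+ 2)%:E * I)%E.
  under eq_integral do rewrite EFinM.
  rewrite ge0_integralZl//; last 3 first.
  - exact/measurable_EFinP.
  - by move=> x _; rewrite lee_fin.
  - by rewrite lee_fin mulr_ge0 ?sqr_ge0.
  apply: (@le_trans _ _ ((D (U 0) ^+ 2 * h ^+ 2)%:E * 113%:E)%E).
    apply: lee_wpmul2l; first by rewrite lee_fin mulr_ge0 ?sqr_ge0.
    exact: symexp_weighted_moment.
  rewrite -EFinM -mulrA EFinM.
  apply: le_trans (lee_wpmul2r _ base_le) _.
    by rewrite lee_fin mulr_ge0 ?sqr_ge0.
  rewrite muleAC -EFinM; apply: lee_wpmul2r => //.
  by rewrite lee_fin; have := sqr_ge0 h; lra.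
apply: (@le_trans _ _ (\int[tau]_x ((J x)%:E + (D (U 0) ^+ 2 * h ^+ 2 * Q x)%:E))%E).
  apply: ge0_le_integral => //.
  - by move=> x _; rewrite lee_fin entropy_gap_ge0.
  - apply/measurable_EFinP.
    exact: (measurableT_comp mphi (measurable_transport_map mu)).
  - apply: emeasurable_funD; apply/measurable_EFinP => //.
    exact: measurable_funM.
  - by move=> x _; rewrite -EFinD lee_fin.
rewrite ge0_integralD//; first last.
- by apply/measurable_EFinP; exact: measurable_funM.
- by move=> x _; rewrite lee_fin mulr_ge0 ?Q_ge0// mulr_ge0 ?sqr_ge0.
- exact/measurable_EFinP.
- by move=> x _; rewrite lee_fin.
apply: le_trans (leeD hJ hQ) _.
have c0 (k : nat) : (0 <= (k%:R * h ^+ 2)%:E)%E.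
  by rewrite lee_fin mulr_ge0 ?ler0n ?sqr_ge0.
rewrite -(ge0_muleDl _ (c0 20) (c0 1017)) -EFinD.
apply: lee_wpmul2r; first exact: I_ge0.
by rewrite lee_fin; have := sqr_ge0 h; lra.
Qed.

End energy.

Let sqr_le_base (u d x : R) : 0 <= d -> 0 <= u -> u <= d * `|U 0 - U x| ->
  u ^+ 2 <= d ^+ 2 * h ^+ 2 * (`|x| + 1) ^+ 2.
Proof.
move=> d0 u0 ud; rewrite -!exprMn ler_sqr ?nnegrE//; last first.
  by rewrite !mulr_ge0 ?addr_ge0// ltW.
apply: le_trans ud _; rewrite -mulrA; apply: ler_wpM2l => //.
by rewrite distrC; exact: transport_map_growth.
Qed.

Let expR_base_ge1 (x : R) : 1 <= expR ((`|x| + 1) / 10).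
Proof. by rewrite -expR0 ler_expR divr_ge0 ?addr_ge0. Qed.

Let base_ge0 (d x : R) :
  0 <= d ^+ 2 * h ^+ 2 * ((`|x| + 1) ^+ 2 * expR ((`|x| + 1) / 10)).
Proof. by apply: mulr_ge0; apply: mulr_ge0; rewrite ?sqr_ge0 ?expR_ge0. Qed.

Let step_ge0 (a s e : R) : 0 <= a -> 0 <= e -> 0 <= 3 / 2 * a + 5 * s ^+ 2 * e.
Proof.
move=> a0 e0; have := mulr_ge0 (sqr_ge0 s) e0; lra.
Qed.

(** The potential is the increasing part of [F]: the gradient at [U x] bounds the
    increase of [F] from [T x] to [x], while the gradient at [U 0] bounds the
    decrease of [F] from [0] to [x]. *)
Lemma convex_log_sobolev : convex_on_line g ->
  (entropy_exp mu g <=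
   (2740 * h ^+ 2)%:E * \int[mu]_x (abs_grad g x ^+ 2 * expR (g x))%:E)%E.
Proof.
move=> gconv.
have D0 := convex_abs_grad_ge0 gconv glip.
have sub := convex_sub_le_abs_grad gconv glip.
pose P (x : MR) : R := Num.max 0 (F x).
have P0 x : 0 <= P x by rewrite le_max lexx.
apply: (@log_sobolev_of_potential (abs_grad g) _ _ _ (fun x => P x ^+ 2 * expR (P x))).
- exact: measurable_convex_abs_grad gconv glip.
- exact: D0.
- exact: convex_abs_grad_side gconv glip _.
- have mP : measurable_fun setT P by exact: measurable_maxr.
  apply: measurable_funM; first exact: measurable_funX.
  exact: measurableT_comp.
- by move=> x; rewrite mulr_ge0 ?sqr_ge0 ?expR_ge0.
- by rewrite /P F0 maxxx expr2 !mul0r.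
- move=> x; have [Fx|Fx] := leP (F x) 0.
    rewrite (_ : P x = 0); last by rewrite /P max_l.
    rewrite expr2 !mul0r.
    by apply: step_ge0; rewrite ?mulr_ge0 ?sqr_ge0 ?expR_ge0.
  have Px : P x = F x by rewrite /P max_r// ltW.
  have FP : F (T x) <= P (T x) by rewrite /P le_max lexx orbT.
  have PF : P x - P (T x) <= F x - F (T x) by rewrite Px lerD2l lerN2.
  rewrite -Px; apply: sqr_expR_step.
  - exact: P0.
  - exact: P0.
  - by apply: mulr_ge0; rewrite ?D0 ?(ltW h_gt0).
  - apply: (le_trans PF); rewrite /F opprB addrA subrK mulrC.
    apply: (le_trans (sub _ _)); apply: ler_wpM2l => //.
    exact: transport_map_soft_threshold.
  - by apply: (le_trans PF); apply: le_trans (F_T x); exact: ler_norm.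
- move=> x; have [Fx|Fx] := leP 0 (F x).
    rewrite /P max_r//; apply: le_trans (entropy_gap_le_pos Fx) _.
    by rewrite lerDl base_ge0.
  rewrite /P (max_l (ltW Fx)) expr2 !mul0r add0r.
  apply: le_trans (entropy_gap_le_neg (ltW Fx)) _.
  have hb : F x ^+ 2 <= abs_grad g (U 0) ^+ 2 * h ^+ 2 * (`|x| + 1) ^+ 2.
    rewrite -sqrrN; apply: sqr_le_base; [exact: D0|by rewrite oppr_ge0 ltW|].
    by rewrite /F opprB; exact: sub.
  apply: (le_trans hb). rewrite [leRHS]mulrA; apply: ler_peMr => //.
  by apply: mulr_ge0; [apply: mulr_ge0|]; rewrite sqr_ge0.
Qed.

(** Mirror image of the convex case: the gradient at [U x] bounds the decrease
    of [F] from [T x] to [x], and the gradient at [U 0] bounds its increase. *)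
Lemma concave_log_sobolev : concave_on_line g ->
  (entropy_exp mu g <=
   (2740 * h ^+ 2)%:E * \int[mu]_x (abs_grad g x ^+ 2 * expR (g x))%:E)%E.
Proof.
move=> gconc.
have nlip : l.-lipschitz (fun x => - g x).
  by move=> [x y] xy /=; rewrite -opprD normrN; exact: (glip xy).
have DE x : abs_grad g x = abs_grad (fun x => - g x) x.
  by rewrite -(abs_gradN gconc nlip); congr (abs_grad _ x); apply/funext => y; rewrite opprK.
have D0 x : 0 <= abs_grad g x by rewrite DE; exact: (convex_abs_grad_ge0 gconc nlip).
have sub x y : g y - g x <= abs_grad g x * `|x - y|.
  by have := convex_sub_le_abs_grad gconc nlip x y; rewrite DE; lra.
pose M (x : MR) : R := Num.min 0 (F x).
have M0 x : M x <= 0 by rewrite ge_min lexx.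
apply: (@log_sobolev_of_potential (abs_grad g) _ _ _ (fun x => phi (M x))).
- rewrite (_ : abs_grad g = abs_grad (fun x => - g x)); last exact/funext.
  exact: measurable_convex_abs_grad gconc nlip.
- exact: D0.
- have [H|H] := convex_abs_grad_side gconc nlip (U 0); [left|right] => y yU;
    by rewrite !DE; exact: H.
- have mM : measurable_fun setT M by exact: measurable_minr.
  rewrite /entropy_gap; apply: measurable_funD => //; apply: measurable_funM.
    exact: measurable_funB.
  exact: measurableT_comp.
- by move=> x; exact: entropy_gap_ge0.
- by rewrite /M F0 minxx entropy_gap0.
- move=> x; have [Fx|Fx] := leP 0 (F x).
    rewrite (_ : M x = 0); last by rewrite /M min_l.
    rewrite entropy_gap0.
    by apply: step_ge0; rewrite ?entropy_gap_ge0 ?expR_ge0.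
  have Mx : M x = F x by rewrite /M min_r// ltW.
  have FM : M (T x) <= F (T x) by rewrite /M ge_min lexx orbT.
  have MF : M (T x) - M x <= F (T x) - F x by rewrite Mx lerD2r.
  rewrite -Mx; apply: entropy_gap_step.
  - exact: M0.
  - exact: M0.
  - by apply: mulr_ge0; rewrite ?D0 ?(ltW h_gt0).
  - apply: (le_trans MF); rewrite /F opprB addrA subrK mulrC.
    apply: (le_trans (sub _ _)); apply: ler_wpM2l => //.
    exact: transport_map_soft_threshold.
  - by apply: (le_trans MF); apply: le_trans (F_T x); rewrite distrC; exact: ler_norm.
- move=> x; have [Fx|Fx] := leP (F x) 0.
    by rewrite /M min_r// lerDl base_ge0.
  rewrite /M (min_l (ltW Fx)) entropy_gap0 add0r.
  apply: le_trans (entropy_gap_le_pos (ltW Fx)) _; rewrite [leRHS]mulrA.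
  apply: ler_pM; rewrite ?sqr_ge0 ?expR_ge0//.
    apply: sqr_le_base => //; first exact: ltW.
    exact: sub.
  by rewrite ler_expR; apply: le_trans (F_growth x); exact: ler_norm.
Qed.

End log_sobolev.

Theorem proposition5p1 (R : realType) (mu : probability (measurableTypeR R) R)
    (h : R) (h_gt0 : 0 < h)
    (hU : (ereal_sup (range (fun x : R =>
             (transport_map mu (x + 1) - transport_map mu x)%:E)) <= h%:E)%E) :
  let K : R := 2740 in
  let c : R := 1 / (10 * Num.sqrt 2) in
  forall (g : R -> R) (l : R),
    convex_on_line g \/ concave_on_line g ->
    l.-lipschitz g ->
    l <= c / h ->
    (entropy_exp mu g <=
     (K * h ^+ 2)%:E *
       \int[mu]_x (abs_grad g x ^+ 2 * expR (g x))%:E)%E.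
Proof.
move=> K c g l gcc glip lc.
have {}hU x : transport_map mu (x + 1) - transport_map mu x <= h.
  by rewrite -lee_fin; apply: le_trans hU; apply: ereal_sup_ubound; exists x.
have l_ge0 : 0 <= l.
  by have := klipschitz_dist 1 0 glip; rewrite subr0 normr1 mulr1; apply: le_trans.
have lh : l * h <= 1 / 10.
  move: lc; rewrite ler_pdivlMr// => /le_trans; apply.
  have s1 : 1 <= Num.sqrt 2 :> R by rewrite -[leLHS]sqrtr1 ler_wsqrtr//; lra.
  by rewrite /c !div1r lef_pV2 ?posrE; lra.
case: gcc => [gconv|gconc].
  exact: (convex_log_sobolev h_gt0 hU glip lh l_ge0).
exact: (concave_log_sobolev h_gt0 hU glip lh l_ge0).
Qed.
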